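(* Let $n_1,n_2$ be nonzero (positive) integers with $n_1+n_2=n-1$ and let $k$ be a real number. Consider the Clifford tori $\mathbb{T}(a,b)=\mathbb{S}^{n_1}(a)\times\mathbb{S}^{n_2}(b)\subset\mathbb{S}^n$ with $a\in\,]0,1[$, $b=\sqrt{1-a^2}$. - If $k>n_1+n_2-2\sqrt{n_1n_2}$, there is no Clifford torus that is properly biharmonic of index $k$. - If $k=n_1+n_2-2\sqrt{n_1n_2}$, there is a unique Clifford torus that is properly biharmonic of index $k$. - If $k<n_1+n_2-2\sqrt{n_1n_2}$, there are exactly two Clifford tori that are properly biharmonic of index $k$ (if $n_1=n_2$, they are $\mathbb{T}(a,b)$ and $\mathbb{T}(b,a)$).
   Context: $\mathbb{S}^n\subset\mathbb{R}^{n+1}$ is the unit sphere with its canonical metric. For $a\in\,]0,1[$ and $b=\sqrt{1-a^2}$, the generalized Clifford torus of radii $a$ and $b$ is $\mathbb{T}(a,b)=\mathbb{T}^{n_1+n_2}(a,b)=\{(x,y)\in\mathbb{R}^{n+1}: x\in\mathbb{R}^{n_1+1},\ y\in\mathbb{R}^{n_2+1},\ |x|=a,\ |y|=b\}\subset\mathbb{S}^n$, with the induced metric. For an $m$-dimensional submanifold $M\subset\mathbb{S}^n$ with inclusion $i$ and second fundamental form $B$, the mean curvature is $H=\frac1m\operatorname{tr}B$; $M$ is harmonic in $\mathbb{S}^n$ if its inclusion is a harmonic map, i.e. if $H=0$. With $\Delta=-\operatorname{tr}\nabla^2$ the (nonnegative) rough Laplacian on sections of $i^*T\mathbb{S}^n$,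 $M$ is biharmonic of index $k$ in $\mathbb{S}^n$ if $(\Delta-m+k)H=0$, and properly so if moreover $M$ is not harmonic in $\mathbb{S}^n$.
   Formalization: The second and third items are stated only for k ≠ 0: at k = 0 one solution of the equation is the harmonic torus, so there is no properly biharmonic Clifford torus if n_1 = n_2 and exactly one if n_1 ≠ n_2, and the printed counts fail. *)

(* Defs.v *)
From HB Require Import structures.
From mathcomp Require Import all_boot all_order all_algebra.
From mathcomp Require Import all_classical all_reals all_analysis.
Set Implicit Arguments.
Unset Strict Implicit.
Unset Printing Implicit Defensive.
Import Order.TTheory GRing.Theory Num.Theory.
Import numFieldNormedType.Exports.
Local Open Scope classical_set_scope.
Local Open Scope ring_scope.

(* The norm that the library puts on 'rV[R]_N is the sup norm, hence the
   Euclidean structure has its own names here.  Topology and derivatives do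
   not depend on the choice of the norm. *)
Definition dot (R : realType) (N : nat) (u v : 'rV[R]_N) : R :=
  \sum_(i < N) u 0 i * v 0 i.

Definition enorm (R : realType) (N : nat) (u : 'rV[R]_N) : R :=
  Num.sqrt (dot u u).

Definition sphere (R : realType) (N : nat) : set 'rV[R]_N :=
  [set p | enorm p = 1].

(* In this section M stands for an m-dimensional smooth submanifold of the unit
   sphere of R^N, and a vector field along M is a function on R^N of which only
   the restriction to M matters.  The values picked by xget are unique in every
   use below: for smooth M, V and u, v tangent to M at p. *)
Section Submanifold.
Variables (R : realType) (N : nat).
Notation E := 'rV[R]_N.
Implicit Types (M : set E) (V : E -> E) (p u v w : E) (k : R).

Definition curve_in M p u (c : R -> E) : Prop :=
  [/\ \forall t \near (0 : R), M (c t), c 0 = p & is_derive (0 : R) (1 : R) c u].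

Definition tangent M p : set E := [set u | exists c, curve_in M p u c].

Definition oproj (T : set E) v : E :=
  xget 0 [set w | T w /\ forall u, T u -> dot (v - w) u = 0].

(* derivative at p, in the direction u tangent to M, of the field V along M *)
Definition dirderiv M V p u : E :=
  xget 0 [set w | forall c, curve_in M p u c ->
                    is_derive (0 : R) (1 : R) (V \o c) w].

(* Levi-Civita connection of M with the metric induced by R^N *)
Definition nabla M V p u : E := oproj (tangent M p) (dirderiv M V p u).

(* pullback to M of the Levi-Civita connection of the sphere, acting on the
   sections of i^*TS *)
Definition nablaS M V p u : E := oproj (tangent (@sphere R N) p) (dirderiv M V p u).

(* A tangent vector v at p is extended to the tangent field x |-> (projection
   of v on T_xM).  The two bilinear maps below are tensors, so that their
   values do not depend on the extension. *)
Definition ext M v : E -> E := fun x => oproj (tangent M x) v.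

(* B(u, v) = nabla^S_u Y - nabla^M_u Y with Y extending v *)
Definition second_fundamental_form M p u v : E :=
  nablaS M (ext M v) p u - nabla M (ext M v) p u.

(* nabla^2_{u, v} V = nabla_X (nabla_Y V) - nabla_{nabla^M_X Y} V with X and Y
   extending u and v *)
Definition nabla2 M V p u v : E :=
  nablaS M (fun x => nablaS M V x (ext M v x)) p u
  - nablaS M V p (nabla M (ext M v) p u).

Definition orthonormal_basis (T : set E) m (e : 'I_m -> E) : Prop :=
  [/\ forall i, T (e i),
      forall i j, dot (e i) (e j) = (i == j)%:R
    & forall v, T v -> v = \sum_(i < m) dot v (e i) *: e i].

Definition trace_on (T : set E) m (beta : E -> E -> E) : E :=
  xget 0 [set w | exists e : 'I_m -> E,
                    orthonormal_basis T e /\ w = \sum_(i < m) beta (e i) (e i)].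

Definition mean_curvature m M p : E :=
  m%:R^-1 *: trace_on (tangent M p) m (second_fundamental_form M p).

Definition rough_laplacian m M V p : E :=
  - trace_on (tangent M p) m (nabla2 M V p).

Definition harmonic m M : Prop :=
  forall p, M p -> mean_curvature m M p = 0.

Definition biharmonic_of_index m M k : Prop :=
  let H := mean_curvature m M in
  forall p, M p -> rough_laplacian m M H p - m%:R *: H p + k *: H p = 0.

Definition properly_biharmonic_of_index m M k : Prop :=
  biharmonic_of_index m M k /\ ~ harmonic m M.

End Submanifold.

(* The ambient dimension is n + 1 = (n1 + 1) + (n2 + 1). *)
Definition torus (R : realType) (n1 n2 : nat) (a b : R) :
    set 'rV[R]_(n1.+1 + n2.+1) :=
  [set z | enorm (lsubmx z) = a /\ enorm (rsubmx z) = b].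
Arguments torus {R} n1 n2 a b.

Definition clifford_torus (R : realType) (n1 n2 : nat)
    (M : set 'rV[R]_(n1.+1 + n2.+1)) : Prop :=
  exists a : R, 0 < a < 1 /\ M = torus n1 n2 a (Num.sqrt (1 - a ^+ 2)).

(* Main.v *)
Require Import Defs.
From HB Require Import structures.
From mathcomp Require Import all_boot all_order all_algebra.
From mathcomp Require Import ring lra.
From mathcomp Require Import all_classical all_reals all_analysis.
Set Implicit Arguments.
Unset Strict Implicit.
Unset Printing Implicit Defensive.
Import Order.TTheory GRing.Theory Num.Theory.
Import numFieldNormedType.Exports.
Local Open Scope classical_set_scope.
Local Open Scope ring_scope.

(** Everything can be computed in closed form.  Put A = a^2, B = b^2 (so A + B = 1) and m = n1 + n2.  Every field that
occurs is obtained from a position vector or a tangent vector by scaling the two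
blocks of coordinates separately: [dil x y (z1, z2) = (x z1, y z2)].

The tangent space of the torus at p is the orthogonal of the two blocks of p.
Extending a tangent vector v by projecting it to nearby tangent spaces and
differentiating at p in the direction u gives the vector
- [dil (u1.v1 / A) (u2.v2 / B)] p, which is normal to the torus.  Hence
B(u, v) = [dil (u.v - u1.v1 / A) (u.v - u2.v2 / B)] p
([second_fundamental_form_torus]).  In an orthonormal basis of the tangent space
the first blocks have squared norms of sum n1 and the second ones n2
([sum_dot1_basis], [sum_dot2_basis]), so that H = [dil al be] p with
al = 1 - n1 / (m A) and be = 1 - n2 / (m B) ([mean_curvature_torus]).  As al and
be are constants, the same derivative formula gives the rough Laplacian of H
([rough_laplacian_torus]), and al A + be B = 0 turns the biharmonic equation into
the product of H with the scalar n1 B/A + n2 A/B - (m - k).  So the torus is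
properly biharmonic of index k iff this scalar vanishes and al <> 0
([properly_biharmonic_torus]).

In terms of t = A/B > 0, which parametrizes the Clifford tori bijectively, the
equation reads n2 t^2 - (m - k) t + n1 = 0, and al <> 0 means n2 t <> n1; the root
t = n1/n2 occurs exactly for k = 0.  Completing the square,
n2 (n2 t^2 - (m - k) t + n1) = (n2 t - r)^2 - (k0 - k) n2 t with
r = sqrt (n1 n2) and k0 = m - 2 r, so there are 0, 1 or 2 positive roots according
to the sign of k0 - k.  The product of two roots is n1/n2; for n1 = n2 they are
inverse to each other, and t |-> 1/t exchanges the two radii. *)

(** * Euclidean linear algebra *)

Section Dot.
Variables (R : realType) (N : nat).
Implicit Types (u v w : 'rV[R]_N) (x : R).

Lemma dotC u v : dot u v = dot v u.
Proof. by apply: eq_bigr => i _; rewrite mulrC. Qed.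

Lemma dotDl u v w : dot (u + v) w = dot u w + dot v w.
Proof. by rewrite -big_split; apply: eq_bigr => i _; rewrite mxE mulrDl. Qed.

Lemma dotZl x u v : dot (x *: u) v = x * dot u v.
Proof. by rewrite mulr_sumr; apply: eq_bigr => i _; rewrite mxE mulrA. Qed.

Lemma dotNl u v : dot (- u) v = - dot u v.
Proof. by rewrite -scaleN1r dotZl mulN1r. Qed.

Lemma dotBl u v w : dot (u - v) w = dot u w - dot v w.
Proof. by rewrite dotDl dotNl. Qed.

Lemma dot0l u : dot 0 u = 0.
Proof. by rewrite -(scale0r 0) dotZl mul0r. Qed.

Lemma dotDr u v w : dot u (v + w) = dot u v + dot u w.
Proof. by rewrite !(dotC u) dotDl. Qed.

Lemma dotZr x u v : dot u (x *: v) = x * dot u v.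
Proof. by rewrite !(dotC u) dotZl. Qed.

Lemma dotBr u v w : dot u (v - w) = dot u v - dot u w.
Proof. by rewrite !(dotC u) dotBl. Qed.

Lemma dot0r u : dot u 0 = 0.
Proof. by rewrite dotC dot0l. Qed.

Lemma dot_suml (I : finType) (f : I -> 'rV[R]_N) v :
  dot (\sum_i f i) v = \sum_i dot (f i) v.
Proof.
by elim/big_rec2: _ => [|i x y _ <-]; rewrite ?dot0l ?dotDl.
Qed.

Lemma dot_ge0 u : 0 <= dot u u.
Proof. by apply: sumr_ge0 => i _; rewrite -expr2 sqr_ge0. Qed.

Lemma dot_eq0 u : dot u u = 0 -> u = 0.
Proof.
move=> /psumr_eq0P u0; apply/rowP => i; rewrite mxE; apply/eqP.
by rewrite -sqrf_eq0 expr2 u0// => j _; rewrite -expr2 sqr_ge0.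
Qed.

Lemma dot_delta u i : dot u (delta_mx 0 i) = u 0 i.
Proof.
rewrite /dot (bigD1 i)//= mxE !eqxx mulr1 big1 ?addr0// => j ji.
by rewrite mxE (negbTE ji) andbF mulr0.
Qed.

Lemma enormP u x : 0 < x -> enorm u = x <-> dot u u = x ^+ 2.
Proof.
move=> x0; split=> [<-|]; first by rewrite sqr_sqrtr// dot_ge0.
by rewrite /enorm => ->; rewrite sqrtr_sqr gtr0_norm.
Qed.

(** The difference of two candidates lies in T and is orthogonal to T; closure
of T under subtraction thus makes the projection unique. *)
Lemma oprojE (T : set 'rV[R]_N) v w :
  (forall x y : 'rV_N, T x -> T y -> T (x - y)) -> T w ->
  (forall u, T u -> dot (v - w) u = 0) -> oproj T v = w.
Proof.
move=> TB Tw ow; apply: xget_subset1 => // x y [Tx ox] [Ty oy].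
apply/eqP; rewrite -subr_eq0; apply/eqP/dot_eq0.
have {1}-> : x - y = (v - y) - (v - x) by rewrite opprB [RHS]addrC subrKA.
by rewrite dotBl oy ?ox ?subr0//; exact: TB.
Qed.

Lemma parseval (T : set 'rV[R]_N) m (e : 'I_m -> 'rV[R]_N) v :
  orthonormal_basis T e -> T v -> \sum_i dot v (e i) ^+ 2 = dot v v.
Proof.
move=> [_ _ eT] /eT {2}->; rewrite dot_suml.
by apply: eq_bigr => i _; rewrite dotZl (dotC (e i)) expr2.
Qed.

(** The definition of the trace quantifies over all orthonormal bases: it has its
expected value once the sum is the same in all of them and there is one. *)
Lemma trace_onE (T : set 'rV[R]_N) m (beta : 'rV[R]_N -> 'rV[R]_N -> 'rV[R]_N) w :
  (exists e : 'I_m -> 'rV[R]_N, orthonormal_basis T e) ->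
  (forall e : 'I_m -> 'rV[R]_N, orthonormal_basis T e ->
     \sum_i beta (e i) (e i) = w) ->
  trace_on T m beta = w.
Proof.
move=> [e0 oe0] bw; apply: xget_unique => [|_ [e [oe ->]]]; last exact: bw.
by exists e0; rewrite bw.
Qed.

End Dot.

(** * Orthonormal bases of a hyperplane *)

Section Reflection.
Variables (R : realType) (N : nat).
Implicit Types (u v w : 'rV[R]_N) (x : R).

Definition reflection w u : 'rV[R]_N := u - (2 * dot w u / dot w w) *: w.

(** For w = 0 the division by zero makes the reflection the identity, so this
and the next lemmas hold for every w. *)
Lemma dot_reflection w u v : dot (reflection w u) (reflection w v) = dot u v.
Proof.
rewrite /reflection; have [w0|w0] := eqVneq (dot w w) 0.
  by rewrite (dot_eq0 w0) !scaler0 !subr0.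
by rewrite dotBl !dotBr !dotZl !dotZr (dotC u w); field.
Qed.

Lemma reflectionK w : involutive (reflection w).
Proof.
move=> u; rewrite /reflection; have [w0|w0] := eqVneq (dot w w) 0.
  by rewrite (dot_eq0 w0) !scaler0 !subr0.
rewrite dotBr dotZr divfK// -addrA -opprD -scalerDl.
suff -> : 2 * dot w u / dot w w + 2 * (dot w u - 2 * dot w u) / dot w w = 0.
  by rewrite scale0r subr0.
by field.
Qed.

Lemma reflection_suml w (I : finType) (x : I -> R) (u : I -> 'rV[R]_N) :
  reflection w (\sum_i x i *: u i) = \sum_i x i *: reflection w (u i).
Proof.
have -> : \sum_i x i *: reflection w (u i) =
    \sum_i x i *: u i - (\sum_i x i * dot w (u i)) *: ((2 / dot w w) *: w).
  rewrite scaler_suml -sumrB; apply: eq_bigr => i _.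
  by rewrite scalerBr !scalerA; congr (_ - _ *: _); ring.
rewrite /reflection dotC dot_suml scalerA; congr (_ - _ *: _).
rewrite -mulrA mulrCA; congr (_ * _); apply: eq_bigr => i _.
by rewrite dotZl dotC.
Qed.

Lemma reflection_swap u v :
  dot u u = dot v v -> reflection (u - v) v = u.
Proof.
move=> uv; rewrite /reflection; set w := u - v.
have [w0|w0] := eqVneq (dot w w) 0.
  by rewrite (dot_eq0 w0) scaler0 subr0; apply/esym/subr0_eq/dot_eq0.
suff -> : 2 * dot w v / dot w w = -1.
  by rewrite scaleN1r opprK addrC subrK.
have -> : 2 * dot w v = - dot w w.
  by rewrite /w !(dotBl, dotBr) (dotC v u) uv; ring.
by rewrite mulNr divff.
Qed.

End Reflection.

(** A reflection that maps the first vector of the standard basis to q maps the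
other ones to an orthonormal basis of the orthogonal of q. *)
Lemma hyperplane_basis (R : realType) n (q : 'rV[R]_n.+1) :
  dot q q = 1 ->
  exists e : 'I_n -> 'rV[R]_n.+1, orthonormal_basis [set v | dot q v = 0] e.
Proof.
move=> q1; pose w := q - delta_mx 0 0; pose d i : 'rV[R]_n.+1 := delta_mx 0 i.
have d00 : reflection w (d 0) = q.
  by apply: reflection_swap; rewrite q1 dot_delta mxE !eqxx.
exists (fun i => reflection w (d (lift 0 i))); split.
- by move=> i /=; rewrite -d00 dot_reflection dot_delta mxE.
- move=> i j; rewrite dot_reflection dot_delta mxE eqxx /=.
  by rewrite (inj_eq lift_inj) eq_sym.
- move=> v /= qv; rewrite -{1}(reflectionK w v).
  rewrite (row_sum_delta (reflection w v)) reflection_suml big_ord_recl.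
  have vd i : reflection w v 0 i = dot v (reflection w (d i)).
    by rewrite -dot_delta -(dot_reflection w) reflectionK.
  rewrite vd d00 dotC qv scale0r add0r.
  by apply: eq_bigr => i _; rewrite vd.
Qed.

(** * Curves and derivatives along a submanifold *)

Section Deriv.
Variable R : realType.

Lemma is_derive_row N (c : R -> 'rV[R]_N) (t : R) u :
  is_derive t 1 c u <-> forall i, is_derive t 1 (fun s => c s 0 i) (u 0 i).
Proof.
split=> [[dc <-] i|dc].
  have dci := (derivable_mxP c t 1).1 dc.
  by split; [exact: dci | rewrite (derive_mx dc) mxE].
have dc' : derivable c t 1.
  by apply/derivable_mxP => i j; rewrite ord1; case: (dc j).
split=> //; apply/rowP => i; rewrite derive_mx// mxE.
by case: (dc i).
Qed.

Lemma is_derive_dot N (c d : R -> 'rV[R]_N) (t : R) u v :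
  is_derive t 1 c u -> is_derive t 1 d v ->
  is_derive t 1 (fun s => dot (c s) (d s)) (dot u (d t) + dot (c t) v).
Proof.
move=> /is_derive_row dc /is_derive_row dd.
rewrite (_ : (fun s => _) =
  \sum_(i < N) ((fun s => c s 0 i) * (fun s => d s 0 i))); last first.
  by apply/funext => s; rewrite fct_sumE.
apply: is_derive_eq.
rewrite /dot -big_split /=; apply: eq_bigr => i _.
by rewrite addrC [u 0 i * _]mulrC.
Qed.

Lemma is_derive_scale N (f : R -> R) (c : R -> 'rV[R]_N) (t df : R) u :
  is_derive t 1 f df -> is_derive t 1 c u ->
  is_derive t 1 (fun s => f s *: c s) (df *: c t + f t *: u).
Proof.
move=> fd /is_derive_row cd; apply/is_derive_row => i.
rewrite (_ : (fun s => _) = f * (fun s => c s 0 i)); last first.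
  by apply/funext => s; rewrite mxE.
by apply: is_derive_eq; rewrite !mxE addrC [df * _]mulrC.
Qed.

Lemma is_derive_row_mx N1 N2 (c : R -> 'rV[R]_N1) (d : R -> 'rV[R]_N2) (t : R) u v :
  is_derive t 1 c u -> is_derive t 1 d v ->
  is_derive t 1 (fun s => row_mx (c s) (d s)) (row_mx u v).
Proof.
move=> /is_derive_row dc /is_derive_row dd; apply/is_derive_row => i.
case: (split_ordP i) => j ->.
  by rewrite row_mxEl; under eq_fun do rewrite row_mxEl.
by rewrite row_mxEr; under eq_fun do rewrite row_mxEr.
Qed.

Lemma is_derive_lsubmx N1 N2 (c : R -> 'rV[R]_(N1 + N2)) (t : R) u :
  is_derive t 1 c u -> is_derive t 1 (fun s => lsubmx (c s)) (lsubmx u).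
Proof.
move=> /is_derive_row dc; apply/is_derive_row => i.
by rewrite mxE; under eq_fun do rewrite mxE.
Qed.

Lemma is_derive_rsubmx N1 N2 (c : R -> 'rV[R]_(N1 + N2)) (t : R) u :
  is_derive t 1 c u -> is_derive t 1 (fun s => rsubmx (c s)) (rsubmx u).
Proof.
move=> /is_derive_row dc; apply/is_derive_row => i.
by rewrite mxE; under eq_fun do rewrite mxE.
Qed.

End Deriv.

Section Arc.
Variables (R : realType) (N : nat).
Implicit Types (p u : 'rV[R]_N) (t : R).

Let speed p u : R := dot u u / (4 * dot p p).

(** A rational parametrization of a great circle through p; unlike
t |-> cos (t w) p + (sin (t w) / w) u with w = |u| / |p|, it needs no case
distinction for u = 0. *)
Definition great_arc p u t : 'rV[R]_N :=
  (1 + speed p u * t ^+ 2)^-1 *: ((1 - speed p u * t ^+ 2) *: p + t *: u).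

Let speed_ge0 p u : 0 <= speed p u.
Proof. by rewrite divr_ge0 ?mulr_ge0 ?dot_ge0. Qed.

Let den_neq0 p u t : 1 + speed p u * t ^+ 2 != 0.
Proof. by rewrite gt_eqF// ltr_pwDl// mulr_ge0 ?speed_ge0 ?sqr_ge0. Qed.

Lemma dot_great_arc p u t : 0 < dot p p -> dot p u = 0 ->
  dot (great_arc p u t) (great_arc p u t) = dot p p.
Proof.
move=> p0 pu; rewrite /great_arc dotZl dotZr.
have uE : dot u u = 4 * speed p u * dot p p.
  by rewrite /speed; field; rewrite gt_eqF.
rewrite !(dotDl, dotDr, dotZl, dotZr) (dotC u p) pu uE.
by have := den_neq0 p u t; move: (speed p u) => s s0; field.
Qed.

Lemma great_arc0 p u : great_arc p u 0 = p.
Proof.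
by rewrite /great_arc expr0n mulr0 addr0 invr1 scale1r subr0 scale1r scale0r addr0.
Qed.

Lemma is_derive_great_arc p u : is_derive (0 : R) 1 (great_arc p u) u.
Proof.
have dq : is_derive (0 : R) 1 (fun t => speed p u * t ^+ 2) 0.
  rewrite (_ : (fun t => _) = speed p u *: (id ^+ 2 : R -> R)); last first.
    by apply/funext => t; rewrite /= fctE.
  by apply: is_derive_eq; rewrite /= !expr1 mulr0 scale0r scaler0.
set q := fun t => _ in dq.
have q0 : q 0 = 0 by rewrite /q expr0n mulr0.
have dden : is_derive (0 : R) 1 (fun t => (1 + q t)^-1) 0.
  have dd : is_derive (0 : R) 1 (fun t => 1 + q t) 0.
    by rewrite -[X in is_derive _ _ _ X]addr0; exact: is_deriveD.
  have := is_deriveV _ dd; rewrite scaler0; apply.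
  by rewrite q0 addr0 oner_neq0.
have dnum : is_derive (0 : R) 1 (fun t => (1 - q t) *: p + t *: u) u.
  have d1 : is_derive (0 : R) 1 (fun t => 1 - q t) 0.
    by rewrite -[X in is_derive _ _ _ X]subr0; exact: is_deriveB.
  have := is_deriveD (is_derive_scale d1 (is_derive_cst p _ _))
    (is_derive_scale (is_derive_id _ _) (is_derive_cst u _ _)).
  by rewrite !(scale0r, scaler0, scale1r, add0r, addr0).
have := is_derive_scale dden dnum.
by rewrite scale0r add0r q0 addr0 invr1 scale1r.
Qed.

End Arc.

Section Curves.
Variables (R : realType) (N : nat).
Implicit Types (M : set 'rV[R]_N) (V W : 'rV[R]_N -> 'rV[R]_N).

(** A field along M may be replaced by any expression W that agrees with it on M
and can be differentiated; the value picked is then unique because u is the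
velocity of at least one curve in M. *)
Lemma dirderivE M V W p u w : tangent M p u -> (forall z, M z -> V z = W z) ->
  (forall c, curve_in M p u c -> is_derive (0 : R) 1 (W \o c) w) ->
  dirderiv M V p u = w.
Proof.
move=> [c0 Mc0] VW dW; apply: xget_unique => [c Mc|w' dw'].
  have [Mc' _ _] := Mc; apply: near_eq_is_derive (dW c Mc).
  by near=> t; rewrite /= VW//; near: t.
have [Mc' _ _] := Mc0.
have [_ <-] : is_derive (0 : R) 1 (W \o c0) w'.
  apply: near_eq_is_derive (dw' c0 Mc0).
  by near=> t; rewrite /= VW//; near: t.
by case: (dW c0 Mc0).
Unshelve. all: by end_near. Qed.

Lemma orthogonal_velocity (c : R -> 'rV[R]_N) (r : R) u :
  (\forall t \near 0, dot (c t) (c t) = r) -> is_derive (0 : R) 1 c u ->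
  dot (c 0) u = 0.
Proof.
move=> cr dc; have [_ e1] := is_derive_dot dc dc.
have [_ e2] : is_derive (0 : R) 1 (fun s => dot (c s) (c s)) 0.
  apply: near_eq_is_derive (is_derive_cst r _ _).
  by near=> t; apply/esym; near: t.
by move: e2; rewrite e1 dotC => /eqP; rewrite -mulr2n mulrn_eq0 => /eqP.
Unshelve. all: by end_near. Qed.

(** The norm is constant along a curve in the sphere; conversely great circles
realize all the vectors orthogonal to p. *)
Lemma tangent_sphere p u : sphere p -> tangent (@sphere R N) p u <-> dot p u = 0.
Proof.
move=> /(enormP _ ltr01); rewrite expr1n => p1; split=> [[c [Mc c0 dc]]|pu].
  rewrite -c0; apply: (orthogonal_velocity (r := 1 ^+ 2)) dc.
  by near=> t; apply/(enormP _ ltr01); near: t.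
exists (great_arc p u); split; [|exact: great_arc0|exact: is_derive_great_arc].
near=> t; apply/(enormP _ ltr01).
by rewrite dot_great_arc// p1// expr1n.
Unshelve. all: by end_near. Qed.

Lemma oproj_sphere p v : sphere p ->
  oproj (tangent (@sphere R N) p) v = v - dot p v *: p.
Proof.
move=> Sp; have p1 := (enormP p ltr01).1 Sp; rewrite expr1n in p1.
apply: oprojE => [x y /tangent_sphere-/(_ Sp) px /tangent_sphere-/(_ Sp) py||].
- by apply/tangent_sphere => //; rewrite dotBr px py subrr.
- by apply/tangent_sphere => //; rewrite dotBr dotZr p1 mulr1 subrr.
- move=> u /tangent_sphere-/(_ Sp) pu.
  by rewrite opprB addrCA subrr addr0 dotZl pu mulr0.
Qed.

End Curves.

(** * Vectors in two blocks *)

Section Blocks.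
Variables (R : realType) (N1 N2 : nat).
Implicit Types (u v w z : 'rV[R]_(N1 + N2)) (x y c : R).

Definition dot1 u v : R := dot (lsubmx u) (lsubmx v).
Definition dot2 u v : R := dot (rsubmx u) (rsubmx v).

(** Independent scaling of the two blocks: the position vector, the normal
directions and the mean curvature field of a torus are all of this form. *)
Definition dil x y z : 'rV[R]_(N1 + N2) :=
  row_mx (x *: lsubmx z) (y *: rsubmx z).

Lemma dot_row_mx (u1 v1 : 'rV[R]_N1) (u2 v2 : 'rV[R]_N2) :
  dot (row_mx u1 u2) (row_mx v1 v2) = dot u1 v1 + dot u2 v2.
Proof.
rewrite /dot big_split_ord; congr (_ + _); apply: eq_bigr => i _.
  by rewrite !row_mxEl.
by rewrite !row_mxEr.
Qed.

Lemma dot_blocks u v : dot u v = dot1 u v + dot2 u v.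
Proof. by rewrite -{1}(hsubmxK u) -{1}(hsubmxK v) dot_row_mx. Qed.

Lemma dot1C u v : dot1 u v = dot1 v u. Proof. exact: dotC. Qed.
Lemma dot2C u v : dot2 u v = dot2 v u. Proof. exact: dotC. Qed.

Lemma dot1_dil x y u v : dot1 u (dil x y v) = x * dot1 u v.
Proof. by rewrite /dot1 row_mxKl dotZr. Qed.

Lemma dot2_dil x y u v : dot2 u (dil x y v) = y * dot2 u v.
Proof. by rewrite /dot2 row_mxKr dotZr. Qed.

Lemma dot1B u v w : dot1 u (v - w) = dot1 u v - dot1 u w.
Proof. by rewrite /dot1 linearB dotBr. Qed.

Lemma dot2B u v w : dot2 u (v - w) = dot2 u v - dot2 u w.
Proof. by rewrite /dot2 linearB dotBr. Qed.

Lemma dilA x y x' y' z : dil x y (dil x' y' z) = dil (x * x') (y * y') z.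
Proof. by rewrite /dil row_mxKl row_mxKr !scalerA. Qed.

Lemma dilxx x z : dil x x z = x *: z.
Proof. by rewrite /dil -scale_row_mx hsubmxK. Qed.

Lemma dil11 z : dil 1 1 z = z.
Proof. by rewrite dilxx scale1r. Qed.

Lemma dil00 z : dil 0 0 z = 0.
Proof. by rewrite dilxx scale0r. Qed.

Lemma dil0 x y : dil x y 0 = 0.
Proof. by rewrite /dil !linear0 row_mx0. Qed.

Lemma dilZ c x y z : c *: dil x y z = dil (c * x) (c * y) z.
Proof. by rewrite /dil scale_row_mx !scalerA. Qed.

Lemma dilD x y x' y' z : dil x y z + dil x' y' z = dil (x + x') (y + y') z.
Proof. by rewrite /dil add_row_mx !scalerDl. Qed.

Lemma dilN x y z : - dil x y z = dil (- x) (- y) z.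
Proof. by rewrite -scaleN1r dilZ !mulN1r. Qed.

Lemma dilB x y x' y' z : dil x y z - dil x' y' z = dil (x - x') (y - y') z.
Proof. by rewrite dilN dilD. Qed.

Lemma dilBr x y u v : dil x y (u - v) = dil x y u - dil x y v.
Proof. by rewrite /dil !linearB /= opp_row_mx add_row_mx. Qed.

Lemma dil_sum (I : finType) (x y : I -> R) z :
  \sum_i dil (x i) (y i) z = dil (\sum_i x i) (\sum_i y i) z.
Proof. by elim/big_rec3: _ => [|i s s' s'' _ ->]; rewrite ?dil00 ?dilD. Qed.

Lemma is_derive_dil (f g : R -> R) (c : R -> 'rV[R]_(N1 + N2)) (t df dg : R) u :
  is_derive t 1 f df -> is_derive t 1 g dg -> is_derive t 1 c u ->
  is_derive t 1 (fun s => dil (f s) (g s) (c s))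
    (dil df dg (c t) + dil (f t) (g t) u).
Proof.
move=> fd gd cd; rewrite /dil add_row_mx; apply: is_derive_row_mx.
  exact/is_derive_scale/is_derive_lsubmx.
exact/is_derive_scale/is_derive_rsubmx.
Qed.

End Blocks.

(** * The tangent spaces of the torus *)

Section Torus.
Variables (R : realType) (n1 n2 : nat) (a b : R).
Hypotheses (a_gt0 : 0 < a) (b_gt0 : 0 < b).
Local Notation T := (torus n1 n2 a b).
Local Notation E := 'rV[R]_(n1.+1 + n2.+1).
Local Notation A := (a ^+ 2).
Local Notation B := (b ^+ 2).
Implicit Types (p u v : E).

Let A_neq0 : A != 0. Proof. by rewrite expf_neq0// gt_eqF. Qed.
Let B_neq0 : B != 0. Proof. by rewrite expf_neq0// gt_eqF. Qed.

Lemma torusP p : T p <-> dot1 p p = A /\ dot2 p p = B.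
Proof. by rewrite /torus /= !enormP. Qed.

(** The norms of both blocks are constant along a curve in the torus; conversely
a pair of great circles, one in each factor, has any prescribed velocity. *)
Lemma tangent_torus p u : T p ->
  tangent T p u <-> dot1 p u = 0 /\ dot2 p u = 0.
Proof.
move=> Tp; have [p1 p2] := (torusP p).1 Tp; split=> [[c [Mc c0 dc]]|[pu1 pu2]].
  rewrite -c0; split.
    apply: (orthogonal_velocity (r := A)) (is_derive_lsubmx dc).
    by near=> t; have /torusP[] : T (c t) by near: t.
  apply: (orthogonal_velocity (r := B)) (is_derive_rsubmx dc).
  by near=> t; have /torusP[] : T (c t) by near: t.
exists (fun t => row_mx (great_arc (lsubmx p) (lsubmx u) t)
                        (great_arc (rsubmx p) (rsubmx u) t)); split.
- near=> t; apply/torusP; rewrite /dot1 /dot2 !row_mxKl !row_mxKr.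
  by rewrite !dot_great_arc// -/(dot1 _ _) -/(dot2 _ _) ?p1 ?p2 ?exprn_gt0.
- by rewrite !great_arc0 hsubmxK.
- have := is_derive_row_mx (is_derive_great_arc (lsubmx p) (lsubmx u))
    (is_derive_great_arc (rsubmx p) (rsubmx u)).
  by rewrite hsubmxK.
Unshelve. all: by end_near. Qed.

Lemma oproj_torus p v : T p ->
  oproj (tangent T p) v = v - dil (dot1 p v / A) (dot2 p v / B) p.
Proof.
move=> Tp; have [p1 p2] := (torusP p).1 Tp.
apply: oprojE => [x y||].
- move=> /tangent_torus-/(_ Tp)[px1 px2] /tangent_torus-/(_ Tp)[py1 py2].
  by apply/tangent_torus => //; rewrite dot1B dot2B px1 px2 py1 py2 subrr.
- apply/tangent_torus => //.
  by rewrite dot1B dot2B dot1_dil dot2_dil p1 p2 !divfK// !subrr.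
- move=> u /tangent_torus-/(_ Tp)[pu1 pu2].
  rewrite opprB addrCA subrr addr0 dotC dot_blocks dot1_dil dot2_dil.
  by rewrite (dot1C u) (dot2C u) pu1 pu2 !mulr0 addr0.
Qed.

(** The union of orthonormal bases of the tangent hyperplanes of the two factors. *)
Lemma torus_basis p : T p ->
  exists e : 'I_(n1 + n2) -> E, orthonormal_basis (tangent T p) e.
Proof.
move=> Tp; have [p1 p2] := (torusP p).1 Tp.
have [e1 [Te1 oe1 de1]] : exists e : 'I_n1 -> 'rV[R]_n1.+1,
    orthonormal_basis [set v | dot (a^-1 *: lsubmx p) v = 0] e.
  by apply: hyperplane_basis; rewrite dotZl dotZr -/(dot1 _ _) p1; field; rewrite gt_eqF.
have [e2 [Te2 oe2 de2]] : exists e : 'I_n2 -> 'rV[R]_n2.+1,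
    orthonormal_basis [set v | dot (b^-1 *: rsubmx p) v = 0] e.
  by apply: hyperplane_basis; rewrite dotZl dotZr -/(dot2 _ _) p2; field; rewrite gt_eqF.
have hyp (c : R) N (q v : 'rV[R]_N) : 0 < c -> dot (c^-1 *: q) v = 0 <-> dot q v = 0.
  move=> c0; rewrite dotZl; split=> [/eqP|->]; last by rewrite mulr0.
  by rewrite mulf_eq0 invr_eq0 gt_eqF//= => /eqP.
exists (fun i => match fintype.split i with
  | inl j => row_mx (e1 j) 0 | inr j => row_mx 0 (e2 j) end); split.
- move=> i; apply/tangent_torus => //; rewrite /dot1 /dot2.
  case: (fintype.split i) => j; rewrite row_mxKl row_mxKr dot0r; split=> //.
    exact/(hyp _ _ _ _ a_gt0)/Te1.
  exact/(hyp _ _ _ _ b_gt0)/Te2.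
- move=> i j; case: (split_ordP i) => i' ->; case: (split_ordP j) => j' ->.
  + rewrite dot_row_mx dot0r addr0 oe1.
    by rewrite (inj_eq (@lshift_inj _ _)).
  + by rewrite dot_row_mx dot0r dot0l addr0 eq_lrshift.
  + by rewrite dot_row_mx dot0r dot0l addr0 eq_rlshift.
  + rewrite dot_row_mx dot0r add0r oe2.
    by rewrite (inj_eq (@rshift_inj _ _)).
- move=> v /tangent_torus-/(_ Tp)[pv1 pv2].
  have suml : \sum_(i < n1) dot v (row_mx (e1 i) 0) *: row_mx (e1 i) 0 =
      row_mx (lsubmx v) (0 : 'rV_n2.+1).
    have /de1 dv := (hyp _ _ _ (lsubmx v) a_gt0).2 pv1.
    rewrite [X in row_mx X _]dv.
    elim/big_rec2: _ => [|i x _ _ ->]; first by rewrite row_mx0.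
    rewrite -{1}(hsubmxK v) dot_row_mx dot0r addr0 scale_row_mx scaler0.
    by rewrite add_row_mx addr0.
  have sumr : \sum_(i < n2) dot v (row_mx 0 (e2 i)) *: row_mx 0 (e2 i) =
      row_mx (0 : 'rV_n1.+1) (rsubmx v).
    have /de2 dv := (hyp _ _ _ (rsubmx v) b_gt0).2 pv2.
    rewrite [X in row_mx _ X]dv.
    elim/big_rec2: _ => [|i x _ _ ->]; first by rewrite row_mx0.
    rewrite -{1}(hsubmxK v) dot_row_mx dot0r add0r scale_row_mx scaler0.
    by rewrite add_row_mx addr0.
  rewrite big_split_ord /=.
  under eq_bigr do rewrite (unsplitK (inl _)).
  under [X in _ + X]eq_bigr do rewrite (unsplitK (inr _)).
  by rewrite suml sumr add_row_mx addr0 add0r hsubmxK.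
Qed.

End Torus.

(** * The curvature of the torus *)

Section TorusCurvature.
Variables (R : realType) (n1 n2 : nat) (a b : R).
Hypotheses (n1_gt0 : (0 < n1)%N) (a_gt0 : 0 < a) (b_gt0 : 0 < b).
Hypothesis ab1 : a ^+ 2 + b ^+ 2 = 1.
Local Notation T := (torus n1 n2 a b).
Local Notation E := 'rV[R]_(n1.+1 + n2.+1).
Local Notation S := (@sphere R (n1.+1 + n2.+1)).
Local Notation A := (a ^+ 2).
Local Notation B := (b ^+ 2).
Local Notation m := (n1 + n2)%N.
Implicit Types (p u v : E) (x y k : R).

Let A_neq0 : A != 0. Proof. by rewrite expf_neq0// gt_eqF. Qed.
Let B_neq0 : B != 0. Proof. by rewrite expf_neq0// gt_eqF. Qed.

Lemma torus_sphere p : T p -> S p.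
Proof.
move=> /(torusP a_gt0 b_gt0)[p1 p2]; apply/(enormP _ ltr01).
by rewrite dot_blocks p1 p2 ab1 expr1n.
Qed.

Lemma tangent_torus0 p : T p -> tangent T p 0.
Proof.
by move=> Tp; apply/tangent_torus => //; rewrite /dot1 /dot2 !linear0 !dot0r.
Qed.

Lemma oproj_sphere_id p v : S p -> dot p v = 0 -> oproj (tangent S p) v = v.
Proof. by move=> Sp pv; rewrite oproj_sphere// pv scale0r subr0. Qed.

Lemma oproj_sphere_dil p x y : T p ->
  oproj (tangent S p) (dil x y p) =
  dil (x - (x * A + y * B)) (y - (x * A + y * B)) p.
Proof.
move=> Tp; have [p1 p2] := (torusP a_gt0 b_gt0 _).1 Tp.
rewrite oproj_sphere; last exact: torus_sphere.
by rewrite dot_blocks dot1_dil dot2_dil p1 p2 -dilxx dilB.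
Qed.

Lemma oproj_torus_dil p x y : T p -> oproj (tangent T p) (dil x y p) = 0.
Proof.
move=> Tp; have [p1 p2] := (torusP a_gt0 b_gt0 _).1 Tp.
rewrite oproj_torus// dot1_dil dot2_dil p1 p2 !mulfK// dilB.
by rewrite !subrr dil00.
Qed.

Lemma dirderiv_dil (V : E -> E) x y p u : T p -> tangent T p u ->
  (forall z, T z -> V z = dil x y z) -> dirderiv T V p u = dil x y u.
Proof.
move=> Tp Tu VW; apply: dirderivE Tu VW _ => c [_ _ dc].
have := is_derive_dil (is_derive_cst x _ _) (is_derive_cst y _ _) dc.
by rewrite dil00 add0r.
Qed.

(** On the torus the field is V z = dil x y (v - dil (z1.v1 / A) (z2.v2 / B) z).
The first term is constant; at p the coefficients z1.v1 and z2.v2 vanish since v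
is tangent, so only their derivatives u1.v1 and u2.v2 contribute.  Both the
extension of v itself (x = y = 1) and the covariant derivatives of H are of
this form. *)
Lemma dirderiv_dil_ext (V : E -> E) x y p u v :
  T p -> tangent T p u -> tangent T p v ->
  (forall z, T z -> V z = dil x y (ext T v z)) ->
  dirderiv T V p u = - dil (x * (dot1 u v / A)) (y * (dot2 u v / B)) p.
Proof.
move=> Tp Tu /(tangent_torus a_gt0 b_gt0 _ Tp)[pv1 pv2] VW.
apply: (@dirderivE _ _ _ _ (fun z => dil x y v -
  dil (x / A * dot1 z v) (y / B * dot2 z v) z)) Tu _ _.
  move=> z Tz; rewrite VW// /ext oproj_torus// dilBr dilA.
  by congr (_ - dil _ _ _); ring.
move=> c [_ c0 dc].
have d1 : is_derive (0 : R) 1 (fun t => x / A * dot1 (c t) v) (x / A * dot1 u v).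
  have := is_derive_dot (is_derive_lsubmx dc) (is_derive_cst (lsubmx v) _ _).
  rewrite dot0r addr0; exact: is_deriveZ.
have d2 : is_derive (0 : R) 1 (fun t => y / B * dot2 (c t) v) (y / B * dot2 u v).
  have := is_derive_dot (is_derive_rsubmx dc) (is_derive_cst (rsubmx v) _ _).
  rewrite dot0r addr0; exact: is_deriveZ.
have := is_deriveB (is_derive_cst (dil x y v) _ _) (is_derive_dil d1 d2 dc).
rewrite c0 pv1 pv2 !mulr0 dil00 addr0 sub0r.
by rewrite ![_ / _ * _]mulrAC -!mulrA.
Qed.

Lemma second_fundamental_form_torus p u v :
  T p -> tangent T p u -> tangent T p v ->
  second_fundamental_form T p u v =
  dil (dot u v - dot1 u v / A) (dot u v - dot2 u v / B) p.
Proof.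
move=> Tp Tu Tv; rewrite /second_fundamental_form /nablaS /nabla.
rewrite (dirderiv_dil_ext (x := 1) (y := 1) Tp Tu Tv); last first.
  by move=> z _; rewrite dil11.
rewrite dilN oproj_sphere_dil// oproj_torus_dil// subr0 dot_blocks.
by congr dil; field; rewrite ?gt_eqF.
Qed.

(** The derivative dil x y u needs no projection: u is tangent to both factors,
so dil x y u is tangent to the torus and a fortiori to the sphere. *)
Lemma nablaS_dil (V : E -> E) x y p u : T p -> tangent T p u ->
  (forall z, T z -> V z = dil x y z) -> nablaS T V p u = dil x y u.
Proof.
move=> Tp Tu VW; rewrite /nablaS (dirderiv_dil Tp Tu VW).
have [pu1 pu2] := (tangent_torus a_gt0 b_gt0 _ Tp).1 Tu.
rewrite oproj_sphere_id//; first exact: torus_sphere.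
by rewrite dot_blocks dot1_dil dot2_dil pu1 pu2 !mulr0 addr0.
Qed.

Lemma tangent_ext p v : T p -> tangent T p (ext T v p).
Proof.
move=> Tp; have [p1 p2] := (torusP a_gt0 b_gt0 _).1 Tp.
rewrite /ext oproj_torus//; apply/tangent_torus => //.
by rewrite dot1B dot2B dot1_dil dot2_dil p1 p2 !divfK// !subrr.
Qed.

(** The extension of u is geodesic at p (nabla_u u = 0, as its derivative is normal
to the torus), so only the iterated derivative remains. *)
Lemma nabla2_dil (V : E -> E) x y p u : T p -> tangent T p u ->
  (forall z, T z -> V z = dil x y z) ->
  nabla2 T V p u u =
  dil (x * dot1 u u + y * dot2 u u - x * (dot1 u u / A))
      (x * dot1 u u + y * dot2 u u - y * (dot2 u u / B)) p.
Proof.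
move=> Tp Tu VW; rewrite /nabla2.
have -> : nabla T (ext T u) p u = 0.
  rewrite /nabla (dirderiv_dil_ext (x := 1) (y := 1) Tp Tu Tu); last first.
    by move=> z _; rewrite dil11.
  by rewrite dilN oproj_torus_dil.
rewrite (nablaS_dil Tp (tangent_torus0 Tp) VW).
rewrite {1}/nablaS (dirderiv_dil_ext (x := x) (y := y) Tp Tu Tu); last first.
  by move=> z Tz; apply: nablaS_dil => //; exact: tangent_ext.
rewrite dilN oproj_sphere_dil// dil0 subr0.
by congr dil; field; rewrite ?gt_eqF.
Qed.

(** Exchange the sums over the basis and over the coordinates of the first block:
the sum over i of the squares of the j-th coordinates of the e i is, by Parseval,
the squared norm of the tangential part f j of the j-th standard vector, that is,
1 - x_j^2 / A.  These sum to n1 + 1 - 1. *)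
Lemma sum_dot1_basis p (e : 'I_m -> E) : T p ->
  orthonormal_basis (tangent T p) e -> \sum_i dot1 (e i) (e i) = n1%:R.
Proof.
move=> Tp oe; have [p1 p2] := (torusP a_gt0 b_gt0 _).1 Tp.
have [Te _ _] := oe.
pose x := lsubmx p.
pose f j : E := row_mx (delta_mx 0 j - (x 0 j / A) *: x) 0.
have Tf j : tangent T p (f j).
  apply/tangent_torus => //; rewrite /dot1 /dot2 row_mxKl row_mxKr dot0r.
  by rewrite dotBr dotZr -/(dot1 _ _) p1 divfK// dot_delta subrr.
have fe j i : dot (f j) (e i) = lsubmx (e i) 0 j.
  have [pe1 _] := (tangent_torus a_gt0 b_gt0 _ Tp).1 (Te i).
  rewrite dot_blocks /dot1 /dot2 row_mxKl row_mxKr dot0l addr0 dotBl dotZl.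
  by rewrite -/(dot1 _ _) pe1 mulr0 subr0 dotC dot_delta.
have ff j : dot (f j) (f j) = 1 - x 0 j * x 0 j / A.
  rewrite dot_row_mx dot0l addr0 !(dotBl, dotBr) !(dotZl, dotZr).
  rewrite dot_delta (dotC _ x) !dot_delta !mxE !eqxx -/(dot1 _ _) p1 /= mulr1n.
  by field; rewrite gt_eqF.
transitivity (\sum_j \sum_i lsubmx (e i) 0 j ^+ 2).
  rewrite exchange_big; apply: eq_bigr => i _.
  by apply: eq_bigr => j _; rewrite expr2.
transitivity (\sum_j (1 - x 0 j * x 0 j / A)).
  apply: eq_bigr => j _; rewrite -ff -(parseval oe (Tf j)).
  by apply: eq_bigr => i _; rewrite fe.
rewrite sumrB sumr_const card_ord -mulr_suml -/(dot x x) -/(dot1 p p) p1 divff//.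
by rewrite -natr1 addrK.
Qed.

Lemma sum_dot2_basis p (e : 'I_m -> E) : T p ->
  orthonormal_basis (tangent T p) e -> \sum_i dot2 (e i) (e i) = n2%:R.
Proof.
move=> Tp oe; have [_ de _] := oe.
have : \sum_i dot (e i) (e i) = m%:R.
  under eq_bigr do rewrite de eqxx.
  by rewrite sumr_const card_ord.
under eq_bigr do rewrite dot_blocks.
by rewrite big_split/= (sum_dot1_basis Tp oe) natrD => /addrI.
Qed.

(** The coefficients of the mean curvature vector H p = (al p1, be p2). *)
Let al : R := 1 - n1%:R / (m%:R * A).
Let be : R := 1 - n2%:R / (m%:R * B).
Let m_neq0 : m%:R != 0 :> R.
Proof. by rewrite pnatr_eq0 -lt0n ltn_addr. Qed.

Lemma mean_curvature_torus p : T p -> mean_curvature m T p = dil al be p.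
Proof.
move=> Tp; rewrite /mean_curvature.
rewrite (@trace_onE _ _ _ _ _
  (dil (m%:R - n1%:R / A) (m%:R - n2%:R / B) p)).
- by rewrite dilZ; congr dil; rewrite /al /be; field;
    rewrite -natrD m_neq0 gt_eqF.
- exact: torus_basis.
move=> e oe; have [Te de _] := oe.
under eq_bigr do rewrite second_fundamental_form_torus// de eqxx.
rewrite dil_sum !sumrB -!mulr_suml (sum_dot1_basis Tp oe) (sum_dot2_basis Tp oe).
by rewrite sumr_const card_ord.
Qed.

Lemma rough_laplacian_torus p : T p ->
  let c := al * n1%:R + be * n2%:R in
  rough_laplacian m T (mean_curvature m T) p =
  dil (al * (n1%:R / A) - c) (be * (n2%:R / B) - c) p.
Proof.
move=> Tp c; rewrite /rough_laplacian.
rewrite (@trace_onE _ _ _ _ _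
  (dil (c - al * (n1%:R / A)) (c - be * (n2%:R / B)) p)).
- by rewrite dilN !opprB.
- exact: torus_basis.
move=> e oe; have [Te de _] := oe.
under eq_bigr do rewrite (nabla2_dil Tp (Te _) mean_curvature_torus).
rewrite dil_sum !sumrB !big_split/= -!mulr_sumr -!mulr_suml.
by rewrite (sum_dot1_basis Tp oe) (sum_dot2_basis Tp oe).
Qed.

Lemma torus_nonempty : exists p, T p.
Proof.
exists (row_mx (a *: delta_mx 0 0) (b *: delta_mx 0 0)); apply/torusP => //.
by rewrite /dot1 /dot2 row_mxKl row_mxKr !dotZl !dotZr !dot_delta !mxE !eqxx !mulr1 !expr2.
Qed.

Lemma dil_eq0 x y p : T p -> dil x y p = 0 <-> x = 0 /\ y = 0.
Proof.
move=> Tp; have [p1 p2] := (torusP a_gt0 b_gt0 _).1 Tp.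
split=> [d0|[-> ->]]; last exact: dil00.
have := dot1_dil x y p p; have := dot2_dil x y p p.
rewrite d0 /dot1 /dot2 !linear0 !dot0r -/(dot1 _ _) -/(dot2 _ _) p1 p2.
move=> /esym/eqP; rewrite mulf_eq0 (negbTE B_neq0) orbF => /eqP->.
by move=> /esym/eqP; rewrite mulf_eq0 (negbTE A_neq0) orbF => /eqP->.
Qed.

(** H is tangent to the sphere. *)
Let albe : al * A + be * B = 0.
Proof.
transitivity (A + B - (n1%:R + n2%:R) / m%:R).
  by rewrite /al /be; field; rewrite -natrD m_neq0 !gt_eqF.
by rewrite ab1 -natrD divff// subrr.
Qed.

Lemma harmonic_torus : Defs.harmonic m T <-> n2%:R * A = n1%:R * B.
Proof.
have alE : al = (n2%:R * A - n1%:R * B) / (m%:R * A).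
  have -> : B = 1 - A by rewrite -ab1 addrC addKr.
  by rewrite /al natrD; field; rewrite -natrD m_neq0 gt_eqF.
have al0 : al = 0 <-> n2%:R * A = n1%:R * B.
  rewrite alE; split=> [/eqP|->]; last by rewrite subrr mul0r.
  rewrite mulf_eq0 invr_eq0 mulf_eq0 (negbTE m_neq0) (negbTE A_neq0) orbF.
  by rewrite orbF subr_eq0 => /eqP.
rewrite -al0; split=> [h|al_0 p Tp].
  have [p Tp] := torus_nonempty; have := h p Tp.
  by rewrite mean_curvature_torus// => /(dil_eq0 _ _ Tp)[].
rewrite mean_curvature_torus//; apply/dil_eq0 => //; split=> //.
have /eqP := albe; rewrite al_0 mul0r add0r mulf_eq0 (negbTE B_neq0) orbF.
by move/eqP.
Qed.

(** Since al A + be B = 0, the left-hand side of the biharmonic equation is F times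
H, where F is the difference of the two sides of the scalar equation. *)
Lemma properly_biharmonic_torus k :
  properly_biharmonic_of_index m T k <->
  n1%:R * (B / A) + n2%:R * (A / B) = m%:R - k /\ n2%:R * A <> n1%:R * B.
Proof.
pose F := n1%:R * (B / A) + n2%:R * (A / B) - (m%:R - k).
have FE p : T p ->
    rough_laplacian m T (mean_curvature m T) p
    - m%:R *: mean_curvature m T p + k *: mean_curvature m T p
    = dil (al * F) (be * F) p.
  move=> Tp; rewrite rough_laplacian_torus// mean_curvature_torus//.
  rewrite !dilZ dilB dilD.
  have alE : al = - be * (B / A).
    apply: (mulIf A_neq0); apply/eqP.
    by rewrite -mulrA divfK// mulNr -addr_eq0 albe.
  have beE : be = - al * (A / B).
    apply: (mulIf B_neq0); apply/eqP.
    by rewrite -mulrA divfK// mulNr -addr_eq0 addrC albe.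
  have AB : n1%:R / A = n1%:R + n1%:R * (B / A).
    by rewrite -{1}[n1%:R]mulr1 -ab1; field; rewrite gt_eqF.
  have BA : n2%:R / B = n2%:R + n2%:R * (A / B).
    by rewrite -{1}[n2%:R]mulr1 -ab1; field; rewrite gt_eqF.
  rewrite AB BA; congr dil; rewrite /F.
    by rewrite beE; ring.
  by rewrite alE; ring.
have F0P : n1%:R * (B / A) + n2%:R * (A / B) = m%:R - k <-> F = 0.
  by rewrite /F; split=> [->|/subr0_eq//]; rewrite subrr.
rewrite -harmonic_torus F0P; split=> [[bi nh]|[F0 nh]]; split=> //.
  have [p Tp] := torus_nonempty; apply/eqP/negPn/negP => F0; apply: nh => q Tq.
  have [/eqP al0 /eqP be0] : al * F = 0 /\ be * F = 0.
    by apply/(dil_eq0 _ _ Tp); rewrite -FE//; exact: bi.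
  rewrite mulf_eq0 (negbTE F0) orbF in al0.
  rewrite mulf_eq0 (negbTE F0) orbF in be0.
  by rewrite mean_curvature_torus// (eqP al0) (eqP be0) dil00.
by move=> p Tp; rewrite /= FE// F0 !mulr0 dil00.
Qed.

End TorusCurvature.

(** * Counting the tori *)

Section Counting.
Variables (R : realType) (n1 n2 : nat).
Hypothesis n1_gt0 : (0 < n1)%N.
Local Notation E := 'rV[R]_(n1.+1 + n2.+1).
Local Notation m := (n1 + n2)%N.
Implicit Types (s t k : R) (M : set E).

(** Clifford tori are parametrized by t = a^2 / b^2, with a^2 + b^2 = 1, because the
biharmonic equation is a quadratic equation in t. *)
Definition ratio_torus t : set E :=
  torus n1 n2 (Num.sqrt (t / (1 + t))) (Num.sqrt (1 + t)^-1).

Lemma ratio_radii t : 0 < t ->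
  [/\ 0 < Num.sqrt (t / (1 + t)) < 1, 0 < Num.sqrt (1 + t)^-1,
      Num.sqrt (t / (1 + t)) ^+ 2 = t / (1 + t),
      Num.sqrt (1 + t)^-1 ^+ 2 = (1 + t)^-1
    & 1 - t / (1 + t) = (1 + t)^-1].
Proof.
move=> t0; have t1 : 0 < 1 + t by rewrite addr_gt0.
have e : 1 - t / (1 + t) = (1 + t)^-1 by field; rewrite gt_eqF.
have q0 : 0 < t / (1 + t) by rewrite divr_gt0.
split=> //; rewrite ?sqr_sqrtr ?sqrtr_gt0 ?invr_gt0// ?ltW ?invr_gt0// q0 /=.
by rewrite -[ltRHS]sqrtr1 ltr_sqrt// -subr_gt0 e invr_gt0.
Qed.

Lemma clifford_torusP M :
  clifford_torus M <-> exists2 t, 0 < t & M = ratio_torus t.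
Proof.
split=> [[a [/andP[a0 a1] ->]]|[t t0 ->]]; last first.
  have [a01 _ a2 _ ab] := ratio_radii t0.
  by exists (Num.sqrt (t / (1 + t))); rewrite a01 a2 ab.
have A1 : 0 < 1 - a ^+ 2 by rewrite subr_gt0 expr_lt1// ltW.
exists (a ^+ 2 / (1 - a ^+ 2)); first by rewrite divr_gt0 ?exprn_gt0.
have e : (1 + a ^+ 2 / (1 - a ^+ 2))^-1 = 1 - a ^+ 2.
  by field; rewrite gt_eqF//= subrK oner_neq0.
by rewrite /ratio_torus e divfK ?gt_eqF// sqrtr_sqr gtr0_norm.
Qed.

Lemma ratio_torus_inj s t :
  0 < s -> 0 < t -> ratio_torus s = ratio_torus t -> s = t.
Proof.
move=> s0 t0 st.
have [/andP[a0 _] b0 A2 B2 _] := ratio_radii s0.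
have [/andP[c0 _] d0 C2 D2 _] := ratio_radii t0.
have [p Tp] := torus_nonempty n1 n2 a0 b0.
have [_] := (torusP a0 b0 p).1 Tp; rewrite B2.
have Tp' : ratio_torus t p by rewrite -st.
have [_ ->] := (torusP c0 d0 p).1 Tp'; rewrite D2 => /invr_inj/addrI.
by move=> /esym.
Qed.

Lemma properly_biharmonic_ratio_torus k t : 0 < t ->
  properly_biharmonic_of_index m (ratio_torus t) k <->
  n2%:R * t ^+ 2 - (m%:R - k) * t + n1%:R = 0 /\ n2%:R * t <> n1%:R.
Proof.
move=> t0; have [/andP[a0 _] b0 A2 B2 ab] := ratio_radii t0.
have t1 : 0 < 1 + t by rewrite addr_gt0.
have AB1 : Num.sqrt (t / (1 + t)) ^+ 2 + Num.sqrt (1 + t)^-1 ^+ 2 = 1.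
  by rewrite A2 B2; field; rewrite gt_eqF.
rewrite (properly_biharmonic_torus n2 n1_gt0 a0 b0 AB1) A2 B2.
have -> : (1 + t)^-1 / (t / (1 + t)) = t^-1 by field; rewrite !gt_eqF.
have -> : t / (1 + t) / (1 + t)^-1 = t by field; rewrite !gt_eqF.
have -> : n1%:R / t + n2%:R * t = m%:R - k <->
    n2%:R * t ^+ 2 - (m%:R - k) * t + n1%:R = 0.
  have <- : (n1%:R / t + n2%:R * t - (m%:R - k)) * t =
    n2%:R * t ^+ 2 - (m%:R - k) * t + n1%:R by field; rewrite gt_eqF.
  split=> [->|/eqP]; first by rewrite subrr mul0r.
  by rewrite mulf_eq0 (gt_eqF t0) orbF => /eqP/subr0_eq.
have -> : n2%:R * (t / (1 + t)) = n1%:R / (1 + t) <-> n2%:R * t = n1%:R.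
  rewrite mulrA; split=> [|->//].
  by apply: mulIf; rewrite invr_eq0 gt_eqF.
by [].
Qed.

(** At n2 t = n1 the quadratic polynomial takes the value k t: for k <> 0 the harmonic
torus never solves the equation. *)
Lemma harmonic_ratio k t : 0 < t ->
  n2%:R * t ^+ 2 - (m%:R - k) * t + n1%:R = 0 -> n2%:R * t = n1%:R -> k = 0.
Proof.
move=> t0; rewrite expr2 mulrA => e nt; rewrite nt in e.
have : k * t = 0 by rewrite -e natrD -nt; ring.
by move/eqP; rewrite mulf_eq0 (gt_eqF t0) orbF => /eqP.
Qed.

Lemma properly_biharmonic_cliffordP k M : k != 0 ->
  clifford_torus M /\ properly_biharmonic_of_index m M k <->
  exists t, [/\ 0 < t, M = ratio_torus t
    & n2%:R * t ^+ 2 - (m%:R - k) * t + n1%:R = 0].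
Proof.
move=> k0; split=> [[/clifford_torusP[t t0 ->]]|[t [t0 -> e]]].
  by move=> /(properly_biharmonic_ratio_torus _ t0)[e _]; exists t.
split; first by apply/clifford_torusP; exists t.
apply/(properly_biharmonic_ratio_torus _ t0); split=> // /(harmonic_ratio t0 e).
exact/eqP.
Qed.

Lemma ratio_torusV t : 0 < t ->
  ratio_torus t^-1 = torus n1 n2 (Num.sqrt (1 + t)^-1) (Num.sqrt (t / (1 + t))).
Proof.
move=> t0; have t1 : 0 < 1 + t by rewrite addr_gt0.
by rewrite /ratio_torus; congr (torus _ _ (Num.sqrt _) (Num.sqrt _)); field;
  rewrite !gt_eqF// addrC.
Qed.

End Counting.
Arguments ratio_torus {R} n1 n2 t.

Theorem proposition1p12 (R : realType) (n1 n2 : nat) (k : R)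
    (n1_gt0 : (0 < n1)%N) (n2_gt0 : (0 < n2)%N) :
  let k0 : R := n1%:R + n2%:R - 2 * Num.sqrt (n1%:R * n2%:R) in
  let PB : set (set 'rV[R]_(n1.+1 + n2.+1)) :=
    [set M | clifford_torus M /\ properly_biharmonic_of_index (n1 + n2) M k] in
  [/\ k0 < k -> PB = set0,
      k = k0 -> k != 0 -> exists! M, PB M
    & k < k0 -> k != 0 ->
        (exists M1 M2, M1 <> M2 /\ PB = [set M1; M2]) /\
        (n1 = n2 -> exists a : R, 0 < a < 1 /\
           let b := Num.sqrt (1 - a ^+ 2) in
           torus n1 n2 a b <> torus n1 n2 b a /\
           PB = [set torus n1 n2 a b; torus n1 n2 b a])].
Proof.
move=> k0 PB.
have n10 : 0 < n1%:R :> R by rewrite ltr0n.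
have n20 : 0 < n2%:R :> R by rewrite ltr0n.
pose r : R := Num.sqrt (n1%:R * n2%:R).
have r0 : 0 < r by rewrite sqrtr_gt0 mulr_gt0.
have rE : r ^+ 2 = n1%:R * n2%:R by rewrite sqr_sqrtr// ltW// mulr_gt0.
pose S : R := (n1 + n2)%:R - k.
(* Completing the square: the sign of S - 2 r = k0 - k decides. *)
have quadE t : n2%:R * (n2%:R * t ^+ 2 - S * t + n1%:R) =
    (n2%:R * t - r) ^+ 2 - (S - 2 * r) * (n2%:R * t).
  by rewrite mulrDr mulrC [n2%:R * n1%:R]mulrC -rE; ring.
have quad0 t : n2%:R * t ^+ 2 - S * t + n1%:R = 0 <->
    (n2%:R * t - r) ^+ 2 = (S - 2 * r) * (n2%:R * t).
  split=> [e|e]; first by apply/subr0_eq; rewrite -quadE e mulr0.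
  by apply: (mulfI (lt0r_neq0 n20)); rewrite quadE e subrr mulr0.
have Sr : S - 2 * r = k0 - k by rewrite /S /k0 -/r natrD; ring.
split.
- move=> k0k; rewrite predeqE => M; split=> // -[/clifford_torusP[t t0 ->]].
  move=> /(properly_biharmonic_ratio_torus n2 n1_gt0 k t0)[/quad0 e _].
  have : 0 <= (n2%:R * t - r) ^+ 2 by exact: sqr_ge0.
  by rewrite e Sr pmulr_lge0 ?mulr_gt0// subr_ge0 leNgt k0k.
- move=> kk0 kn0; exists (ratio_torus n1 n2 (r / n2%:R)); split=> [|M].
    apply/properly_biharmonic_cliffordP => //.
    exists (r / n2%:R); split; rewrite ?divr_gt0//; apply/quad0.
    by rewrite Sr kk0 mulrC divfK ?gt_eqF// !subrr mul0r expr0n.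
  move=> /properly_biharmonic_cliffordP-/(_ n1_gt0 kn0)[t [t0 -> /quad0]].
  rewrite Sr kk0 subrr mul0r => /eqP; rewrite sqrf_eq0 => /eqP/subr0_eq <-.
  by rewrite [_ * t]mulrC mulfK ?gt_eqF.
move=> kk0 kn0.
have Sr0 : 0 < S - 2 * r by rewrite Sr subr_gt0.
(* The two roots; positivity comes from D < S, since S^2 - D^2 = 4 n1 n2. *)
pose D := Num.sqrt (S ^+ 2 - 4 * r ^+ 2).
have D2 : D ^+ 2 = S ^+ 2 - 4 * r ^+ 2 by rewrite sqr_sqrtr; nra.
have D0 : 0 < D by rewrite sqrtr_gt0; nra.
have DS : D < S by nra.
pose t1 := (S + D) / (2 * n2%:R); pose t2 := (S - D) / (2 * n2%:R).
have t10 : 0 < t1 by rewrite divr_gt0 ?mulr_gt0// addr_gt0// (lt_trans D0).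
have t20 : 0 < t2 by rewrite divr_gt0 ?mulr_gt0// subr_gt0.
have t12 : t1 * t2 = n1%:R / n2%:R.
  have -> : t1 * t2 = (S ^+ 2 - D ^+ 2) / (4 * n2%:R ^+ 2).
    by rewrite /t1 /t2; field; rewrite gt_eqF.
  by rewrite D2 rE; field; rewrite gt_eqF.
have factorE t : n2%:R * t ^+ 2 - S * t + n1%:R = n2%:R * ((t - t1) * (t - t2)).
  have -> : (t - t1) * (t - t2) = t ^+ 2 - (t1 + t2) * t + t1 * t2 by ring.
  have -> : t1 + t2 = S / n2%:R by rewrite /t1 /t2; field; rewrite gt_eqF.
  by rewrite t12; field; rewrite gt_eqF.
have t1_neq2 : t1 <> t2.
  by move=> /(mulIf (invr_neq0 (lt0r_neq0 (mulr_gt0 (ltr0Sn _ 1) n20)))); lra.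
have M12 : ratio_torus n1 n2 t1 <> ratio_torus n1 n2 t2.
  by move=> /ratio_torus_inj-/(_ t10 t20).
have PBE : PB = [set ratio_torus n1 n2 t1; ratio_torus n1 n2 t2].
  rewrite predeqE => M; split.
    move=> /properly_biharmonic_cliffordP-/(_ n1_gt0 kn0)[t [t0 ->]].
    rewrite factorE => /eqP; rewrite !mulf_eq0 (gt_eqF n20) !subr_eq0 /=.
    by move=> /orP[/eqP->|/eqP->]; [left|right].
  move=> MM; apply/properly_biharmonic_cliffordP => //.
  case: MM => ->; [exists t1|exists t2]; split=> //;
    by rewrite factorE subrr ?mul0r ?mulr0.
split; first by exists (ratio_torus n1 n2 t1), (ratio_torus n1 n2 t2).
move=> n12; exists (Num.sqrt (t1 / (1 + t1))).
have [a01 _ a2 _ ab] := ratio_radii t10; split=> //=.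
rewrite a2 ab -(ratio_torusV n1 n2 t10).
(* The product of the roots is n1 / n2 = 1. *)
suff -> : t1^-1 = t2 by [].
by apply: (mulfI (lt0r_neq0 t10)); rewrite t12 divff ?gt_eqF// n12 divff ?gt_eqF.
Qed.
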